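(* Let $n\ge 1$ and let $S\subseteq\mathbb{R}^n_{\ge 0}$ be an s-surface. Then for every inner point $x\in S$ (a point of $S$ with all coordinates strictly positive) and all $1\le i,j\le n$, $$\mathrm{OPT}(S)\;\ge\;\frac{\nabla S_j(x)}{\nabla S_i(x)},$$ where $\nabla S_i(x)$ denotes the $i$-th coordinate of the outward normal vector $\nabla S(x)$ of $S$ at $x$.
   Context: Notation: $\mathbb{R}^n_{\ge0}=\{x\in\mathbb{R}^n: x_i\ge 0 \text{ for all } i\}$; $x\le y$ means $x_i\le y_i$ for all $i$; $\min(x,y)$ and $\max(x,y)$ are taken coordinatewise; $e_i$ is the $i$-th unit vector. EL function: a function $f:\mathbb{R}^n_{\ge0}\to\mathbb{R}$ is entropy-like (EL) if (1) it is submodular: $f(x)+f(y)\ge f(\min(x,y))+f(\max(x,y))$ for all $x,y\in\mathbb{R}^n_{\ge0}$; (2) $f(0)=0$; (3) $f$ is non-decreasing: $0\le x\le y$ implies $f(x)\le f(y)$; (4) it has the Diminishing Returns property: for every $x\ge0$, every $i$, every $\lambda>0$ and $\varepsilon>0$, with $y=x+\lambda e_i$, one has $f(x+\varepsilon e_i)-f(x)\ge f(y+\varepsilon e_i)-f(y)$. Left and right partial derivatives: $f^-_i(x)=\lim_{\varepsilon\to+0}\frac{f(x)-f(x-\varepsilon e_i)}{\varepsilon}$ (for $x_i>0$) and $f^+_i(x)=\lim_{\varepsilon\to+0}\frac{f(x+\varepsilon e_i)-f(x)}{\varepsilon}$; the value $+\infty$ is allowed for $f_i^+$ when $x_i=0$.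 Cost: $\mathrm{Cost}(f)=\max\{f^+_1(0),\dots,f^+_n(0)\}$, which may be $+\infty$. s-surface: a smooth $(n-1)$-dimensional surface $S\subseteq\mathbb{R}^n_{\ge0}$ separating a downward closed set of (''unqualified'') points of $\mathbb{R}^n_{\ge0}$ containing the origin from the remaining (''qualified'') points, such that (a) $0\notin S$, (b) $S$ is compact, and (c) for every $x\in S$ the normal vector $\nabla S(x)$ of $S$ at $x$ pointing outwards (towards the qualified points) has strictly positive coordinates. (A set $D$ is downward closed if $x\in D$ and $0\le y\le x$ imply $y\in D$.) Feasibility: an EL function $f$ is $S$-feasible if $f^-_i(x)-f^+_i(x)\ge1$ for all $1\le i\le n$ and all $x\in S$ with all coordinates strictly positive. $\mathrm{OPT}(S)$ is the infimum of $\mathrm{Cost}(f)$ over all $S$-feasible EL functions $f$ ($+\infty$ if there are none). *)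

(* Defs.v *)
From HB Require Import structures.
From mathcomp Require Import all_boot all_order all_algebra.
From mathcomp Require Import all_classical all_reals all_analysis.
Set Implicit Arguments.
Unset Strict Implicit.
Unset Printing Implicit Defensive.
Import Order.TTheory GRing.Theory Num.Theory.
Import numFieldNormedType.Exports.
Local Open Scope classical_set_scope.
Local Open Scope ring_scope.

Section Definitions.
Context {R : realType} {n : nat}.
Implicit Types (x y v : 'rV[R]_n) (f g : 'rV[R]_n -> R) (S D U : set 'rV[R]_n).

Definition orthant : set 'rV[R]_n := [set x | forall i, 0 <= x 0 i].

Definition vle x y : Prop := forall i, x 0 i <= y 0 i.
Definition vmin x y : 'rV[R]_n := \row_i Num.min (x 0 i) (y 0 i).
Definition vmax x y : 'rV[R]_n := \row_i Num.max (x 0 i) (y 0 i).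

Definition unitv (i : 'I_n) : 'rV[R]_n := delta_mx 0 i.

(* A function on the orthant is represented by a total function on R^n; every
   notion below, with left_pderiv taken only where 0 < x 0 i, depends only on its
   values on the orthant. *)
Record entropy_like f : Prop := EntropyLike {
  el_submodular : forall x y, orthant x -> orthant y ->
    f (vmin x y) + f (vmax x y) <= f x + f y;
  el_zero : f 0 = 0;
  el_nondecreasing : forall x y, orthant x -> vle x y -> f x <= f y;
  el_diminishing : forall x (i : 'I_n) (lam eps : R),
    orthant x -> 0 < lam -> 0 < eps ->
    let y := x + lam *: unitv i in
    f (y + eps *: unitv i) - f y <= f (x + eps *: unitv i) - f x }.

(* The limits are taken in the extended reals. For entropy-like f the difference
   quotients are monotone in e, so both limits exist (the left one where
   0 < x 0 i), and both are finite where 0 < x 0 i. *)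
Definition left_pderiv f (i : 'I_n) x : \bar R :=
  lim ((((f x - f (x - e *: unitv i)) / e)%:E : \bar R) @[e --> 0^'+]).

Definition right_pderiv f (i : 'I_n) x : \bar R :=
  lim ((((f (x + e *: unitv i) - f x) / e)%:E : \bar R) @[e --> 0^'+]).

Definition Cost f : \bar R := \big[Order.max/-oo%E]_(i < n) right_pderiv f i 0.

Definition inner x : Prop := forall i, 0 < x 0 i.

Definition feasible S f : Prop :=
  forall (i : 'I_n) x, S x -> inner x ->
    (1 <= left_pderiv f i x - right_pderiv f i x)%E.

Definition OPT S : \bar R :=
  ereal_inf [set Cost f | f in [set f | entropy_like f /\ feasible S f]].

(* g has continuous partial derivatives up to order k on the open set U. *)
Fixpoint class_C (k : nat) U g : Prop :=
  (forall x, U x -> {for x, continuous g}) /\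
  (if k is k'.+1 then
     forall i : 'I_n, (forall x, U x -> derivable g x (unitv i)) /\
                      class_C k' U (fun x => 'D_(unitv i) g x)
   else True).

Definition smooth_on U g : Prop := forall k, class_C k U g.

Definition gradient g x : 'rV[R]_n := \row_i 'D_(unitv i) g x.

(* Near its point x the surface S is the zero set, within the orthant, of g,
   which is negative only at points of D and positive only outside D. The
   neighborhood U is open in R^n: also at a point on the boundary of the orthant,
   g is smooth across that boundary. *)
Definition local_equation S D x U g : Prop :=
  [/\ open U, U x, smooth_on U g, gradient g x != 0 &
      forall y, U y -> orthant y ->
        [/\ S y <-> g y = 0, g y < 0 -> D y & 0 < g y -> ~ D y]].

(* v is a normal of S at x directed away from D; its length is unconstrained. *)
Definition outward_normal S D x v : Prop :=
  exists U g, local_equation S D x U g /\ v = gradient g x.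

Definition downward_closed D : Prop :=
  forall x y, D x -> orthant y -> vle y x -> D y.

(* S is the boundary, relative to the orthant, between D and the rest of it.
   The points of S themselves may or may not belong to D. *)
Definition separates S D : Prop :=
  S = closure D `&` closure (orthant `\` D).

(* D is the set of unqualified points. *)
Record s_surface S D : Prop := SSurface {
  ss_sub : S `<=` orthant;
  ss_unqualified_sub : D `<=` orthant;
  ss_unqualified_down : downward_closed D;
  ss_unqualified_zero : D 0;
  ss_separates : separates S D;
  ss_smooth : forall x, S x -> exists v, outward_normal S D x v;
  ss_zero : ~ S 0;
  ss_compact : compact S;
  ss_normal_pos : forall x v, S x -> outward_normal S D x v ->
    forall i, 0 < v 0 i }.

End Definitions.

(* Main.v *)
Require Import Defs.
From HB Require Import structures.
From mathcomp Require Import all_boot all_order all_algebra.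
From mathcomp Require Import all_classical all_reals all_analysis.
From mathcomp Require Import ring lra.
Set Implicit Arguments.
Unset Strict Implicit.
Unset Printing Implicit Defensive.
Import Order.TTheory GRing.Theory Num.Theory.
Import numFieldNormedType.Exports.
Local Open Scope classical_set_scope.
Local Open Scope ring_scope.

(** Crossing the surface lowers the [i]-th derivative of a feasible function [f]
    by at least 1. If [f] were smooth on both sides of the surface, the jump of
    its gradient would be parallel to the normal [v], so the [j]-th derivative
    would drop by at least [v_j / v_i]; as [f] is non-decreasing, it was at least
    that large before the drop, and the [j]-th derivative at the origin, which
    is the largest one, is no smaller.

    The argument below is a discrete form of this and needs no regularity of
    [f]. Submodularity and diminishing returns together say that the increment
    of [f] in a coordinate direction is a non-increasing function of the base
    point ([increment_antitone]). Hence [f] is concave along the axes, one-sided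
    derivatives are extrema of difference quotients, and feasibility becomes a
    lower bound [s] on second differences of step [s] at the points of the
    surface ([feasible_second_difference]).

    Fix [rho < v_j / v_i]. Near the inner point [x], on the strip of points
    [x - r e_i + c e_j] with [0 <= r <= rho d] and [0 <= c <= d], the surface
    separates the lower edge [c = 0] from the upper edge [c = d]: every vertical
    segment meets it ([surface_crossing], which rests on the mean value and
    intermediate value theorems). Monotonicity of increments transports the kink
    at the crossing point to the edges, so the slope of [f] in direction [e_i]
    is smaller by at least 1 on the upper edge than on the lower one. Adding
    this up over [r], the difference of [f] between the two edges is larger by
    [rho d] at the far end of the strip than at [x], where it is nonnegative. A
    climb of height [d] along [e_j] thus gains at least [rho d], whereas the
    cost bounds this gain by [Cost f * d]; so [rho <= Cost f]
    ([slope_le_Cost]). *)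

(** * Increments of entropy-like functions *)

(** The last increment is at most each of the first [m] ones, hence at most
    their average, so adding it does not raise the mean slope. *)
Lemma concave_seq_chord (R : realDomainType) (u : nat -> R) (m M : nat) :
  (forall k l, (k <= l)%N -> u l.+1 - u l <= u k.+1 - u k) ->
  (m <= M)%N -> m%:R * (u M - u 0%N) <= M%:R * (u m - u 0%N).
Proof.
move=> du; elim: M => [|M IHM]; first by rewrite leqn0 => /eqP ->; rewrite !mul0r.
rewrite leq_eqVlt => /predU1P[-> //|]; rewrite ltnS => mM.
have last_step : m%:R * (u M.+1 - u M) <= u m - u 0%N.
  rewrite -(telescope_sumr u (leq0n m)) big_mkord mulr_natl.
  rewrite -[in leLHS](card_ord m) -sumr_const; apply: ler_sum => k _.
  by apply: du; rewrite (leq_trans (ltnW (ltn_ord k))).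
have := lerD (IHM mM) last_step; rewrite -mulrDr -[M.+1%:R]natr1 mulrDl mul1r.
by rewrite [X in _ * X]addrC addrA subrK.
Qed.

Section EntropyLike.
Context {R : realType} {n : nat}.
Implicit Types (p q x : 'rV[R]_n) (f : 'rV[R]_n -> R) (i j k : 'I_n) (s t : R).

Lemma shiftE x s i k : (x + s *: unitv i) 0 k = x 0 k + s *+ (k == i).
Proof. by rewrite !mxE eqxx /= mulr_natr. Qed.

Lemma vle_shift p s t i : s <= t -> vle (p + s *: unitv i) (p + t *: unitv i).
Proof. by move=> st k; rewrite !shiftE lerD2l; case: (k == i). Qed.

Lemma vle_shiftr p s i : 0 <= s -> vle p (p + s *: unitv i).
Proof. by move=> s0 k; rewrite shiftE lerDl mulrn_wge0. Qed.

Lemma vle_trans q p x : vle p q -> vle q x -> vle p x.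
Proof. by move=> pq qx k; exact: le_trans (qx k). Qed.

Lemma orthant_vle p q : orthant p -> vle p q -> orthant q.
Proof. by move=> p0 pq k; exact: le_trans (pq k). Qed.

Lemma orthant0 : orthant (0 : 'rV[R]_n).
Proof. by move=> k; rewrite mxE. Qed.

(** Go from [p] to [q] in two stages. Moving the [i]-th coordinate lowers the
    increment by diminishing returns. The intermediate point [r] then agrees
    with [q] in that coordinate, so [q] and [r + s e_i] have minimum [r] and
    maximum [q + s e_i], and submodularity handles the other coordinates. *)
Lemma increment_antitone f p q i s : entropy_like f ->
  orthant p -> vle p q -> 0 <= s ->
  f (q + s *: unitv i) - f q <= f (p + s *: unitv i) - f p.
Proof.
move=> Hf p0 pq; rewrite le_eqVlt => /predU1P[<-|s0].
  by rewrite scale0r !addr0 !subrr.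
pose r := p + (q 0 i - p 0 i) *: unitv i.
have rE k : r 0 k = if k == i then q 0 i else p 0 k.
  by rewrite shiftE; case: eqP => [->|_]; rewrite ?addr0 // addrC subrK.
have q0 := orthant_vle p0 pq.
have r0 : orthant r by move=> k; rewrite rE; case: ifP.
have dr : f (r + s *: unitv i) - f r <= f (p + s *: unitv i) - f p.
  have := pq i; rewrite le_eqVlt => /predU1P[pqi|pqi].
    by rewrite /r pqi subrr scale0r addr0.
  by apply: (el_diminishing Hf) => //; rewrite subr_gt0.
apply: le_trans dr; clearbody r.
have rs0 := orthant_vle r0 (vle_shiftr r i (ltW s0)).
have := el_submodular Hf q0 rs0.
have -> : vmin q (r + s *: unitv i) = r.
  apply/rowP => k; rewrite [LHS]mxE shiftE rE; case: eqP => [->|_].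
    by rewrite min_l // lerDl ltW.
  by rewrite addr0 min_r.
have -> : vmax q (r + s *: unitv i) = q + s *: unitv i.
  apply/rowP => k; rewrite [LHS]mxE !shiftE rE; case: eqP => [->|_].
    by rewrite max_r // lerDl ltW.
  by rewrite !addr0 max_l.
lra.
Qed.

(** Concavity along an axis, as monotonicity of difference quotients. Only
    increments of equal length can be compared directly, so [s] is cut into
    [m] steps [h] and [t] is rounded up to [M] of them; monotonicity of [f]
    absorbs the rounding, which costs at most [s a / m]. *)
Lemma entropy_like_chord f p i s t : entropy_like f -> orthant p ->
  0 <= s <= t ->
  s * (f (p + t *: unitv i) - f p) <= t * (f (p + s *: unitv i) - f p).
Proof.
move=> Hf p0 /andP[]; rewrite le_eqVlt => /predU1P[<- _|s0 st].
  by rewrite mul0r scale0r addr0 subrr mulr0.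
set a := f (p + s *: unitv i) - f p.
have a0 : 0 <= a.
  by rewrite subr_ge0; apply: (el_nondecreasing Hf) => //; exact/vle_shiftr/ltW.
apply/ler_addgt0Pr => eps eps0.
(* fine enough for the rounding error [s a / m] to be at most [eps] *)
pose m := (Num.truncn (s * a / eps)).+1.
have m0 : 0 < m%:R :> R by rewrite ltr0n.
have sam : s * a <= eps * m%:R.
  by rewrite -ler_pdivrMl // mulrC ltW // truncnS_gt.
pose h := s / m%:R.
have h0 : 0 < h by rewrite divr_gt0.
have mh : m%:R * h = s by rewrite mulrC divfK ?gt_eqF.
pose M := (Num.truncn (t / h)).+1.
have th0 : 0 <= t / h by rewrite divr_ge0 ?ltW // (lt_le_trans s0).
have tM : t <= M%:R * h by rewrite -ler_pdivrMr // ltW // truncnS_gt.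
have Mt : M%:R * h <= t + h.
  by rewrite -natr1 mulrDl mul1r lerD2r -ler_pdivlMr // truncn_le.
have mM : (m <= M)%N by rewrite -(ler_nat R) -(ler_pM2r h0) mh (le_trans st).
have := @concave_seq_chord R (fun r : nat => f (p + (r%:R * h) *: unitv i)) m M.
rewrite mul0r scale0r addr0 mh -/a => /(_ _ mM) H.
have {H} : m%:R * (f (p + (M%:R * h) *: unitv i) - f p) <= M%:R * a.
  apply: H => k l kl.
  have E r : p + (r.+1%:R * h) *: unitv i = p + (r%:R * h) *: unitv i + h *: unitv i.
    by rewrite -natr1 mulrDl mul1r scalerDl addrA.
  rewrite !E; apply: increment_antitone => //; last exact: ltW.
    by apply: (orthant_vle p0); apply: vle_shiftr; rewrite mulr_ge0 // ltW.
  by apply: vle_shift; rewrite ler_pM2r // ler_nat.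
move=> H; apply: (@le_trans _ _ (s * (f (p + (M%:R * h) *: unitv i) - f p))).
  rewrite ler_pM2l // lerD2r; apply: (el_nondecreasing Hf); last exact: vle_shift.
  by apply: (orthant_vle p0); apply: vle_shiftr; rewrite (le_trans (ltW s0)).
move: (ler_wpM2l (ltW h0) H); set b := f _ - f p.
rewrite ![h * (_ * _)]mulrA ![h * _%:R]mulrC mh => {}H.
apply: (le_trans H); apply: (le_trans (ler_wpM2r a0 Mt)).
by rewrite mulrDl lerD2l /h mulrAC ler_pdivrMr.
Qed.

(** * Feasibility as a bound on second differences *)

(** The quotients grow as the step shrinks, so the limit is their supremum. *)
Lemma quotient_le_right_pderiv f p i s : entropy_like f -> orthant p -> 0 < s ->
  (((f (p + s *: unitv i) - f p) / s)%:E <= right_pderiv f i p)%E.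
Proof.
move=> Hf p0 s0; pose F e : \bar R := ((f (p + e *: unitv i) - f p) / e)%:E.
have -> : right_pderiv f i p = ereal_sup (F @` [set` `]0, +oo[]).
  apply/cvg_lim => //; apply: nonincreasing_at_right_cvge => // d e.
  rewrite !in_itv /= !andbT => d0 e0 de; rewrite lee_fin ler_pdivrMr //.
  rewrite mulrAC ler_pdivlMr // mulrC [leRHS]mulrC.
  by apply: entropy_like_chord => //; rewrite ltW.
by apply: ereal_sup_ubound; exists s => //=; rewrite in_itv /= s0.
Qed.

(** The quotients decrease as the step shrinks within [0, x_i], so the limit is
    their infimum. *)
Lemma left_pderiv_le_quotient f x i s : entropy_like f -> orthant x ->
  0 < s < x 0 i ->
  (left_pderiv f i x <= ((f x - f (x - s *: unitv i)) / s)%:E)%E.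
Proof.
move=> Hf x0 /andP[s0 sx]; pose F e : \bar R := ((f x - f (x - e *: unitv i)) / e)%:E.
have -> : left_pderiv f i x = ereal_inf (F @` [set` `]0, x 0 i[]).
  apply/cvg_lim => //; apply: nondecreasing_at_right_cvge.
    by rewrite bnd_simp (lt_trans s0).
  move=> d e; rewrite !in_itv /= => /andP[d0 _] /andP[e0 ex] de.
  rewrite lee_fin ler_pdivlMr // mulrAC ler_pdivrMr //.
  have xe0 : orthant (x - e *: unitv i).
    move=> k; rewrite -scaleNr shiftE; case: eqP => [->|_]; rewrite ?addr0 //.
    by rewrite subr_ge0 ltW.
  (* Concavity seen from the lower end [x - e e_i]: the part of length [e - d]
     has at least its share of the increment, leaving less for the rest. *)
  have := @entropy_like_chord f (x - e *: unitv i) i (e - d) e Hf xe0.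
  rewrite subrK scalerBl addrA subrK subr_ge0 de lerBlDr lerDl ltW // => /(_ isT).
  lra.
by apply: ereal_inf_lbound; exists s => //=; rewrite in_itv /= s0.
Qed.

(** Difference quotients bound the one-sided derivatives from the favourable
    sides, so the unit kink persists at every finite scale [s]. *)
Lemma feasible_second_difference S f x i s : entropy_like f -> feasible S f ->
  S x -> inner x -> 0 < s < x 0 i ->
  s <= (f x - f (x - s *: unitv i)) - (f (x + s *: unitv i) - f x).
Proof.
move=> Hf HS Sx xi sx; have [s0 _] := andP sx.
have x0 : orthant x by move=> k; exact/ltW/xi.
have := le_trans (HS i x Sx xi) (leeB (left_pderiv_le_quotient Hf x0 sx)
  (quotient_le_right_pderiv i Hf x0 s0)).
by rewrite -EFinB lee_fin -mulrBl ler_pdivlMr // mul1r.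
Qed.

(** * Kinks along a slanted surface *)

(** Increments are largest at the origin, where the cost bounds them. *)
Lemma increment_le_Cost f p i s (C : R) : entropy_like f -> (Cost f <= C%:E)%E ->
  orthant p -> 0 <= s -> f (p + s *: unitv i) - f p <= C * s.
Proof.
move=> Hf HC p0; rewrite le_eqVlt => /predU1P[<-|s0].
  by rewrite scale0r addr0 subrr mulr0.
have p_ge0 : vle 0 p by move=> k; rewrite mxE; exact: p0.
apply: (le_trans (increment_antitone i Hf orthant0 p_ge0 (ltW s0))).
rewrite -ler_pdivrMr // -lee_fin; apply: le_trans HC.
apply: (le_trans (quotient_le_right_pderiv i Hf orthant0 s0)).
exact: (le_bigmax _ (fun k => right_pderiv f k 0)).
Qed.

(** The strip [x - r e_i + c e_j] is sampled at multiples of a step [s]; each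
    vertical segment of it carries a point of the surface. Passing from the
    lower edge [c = 0] to the upper one [c = d] lowers the slope along [e_i] by
    at least 1 ([step]). Summed over the strip, this makes the climb from the
    lower to the upper edge at the far end gain [rho d], up to an error of order
    [s] ([bound]), while the cost allows it at most [C d]. *)
Lemma slope_le_Cost f S x i j (rho d C : R) :
  entropy_like f -> feasible S f -> (Cost f <= C%:E)%E ->
  inner x -> 0 < rho -> 0 < d -> rho * d + rho * d < x 0 i ->
  (forall t, 0 <= t <= rho * d ->
    exists2 c, 0 <= c <= d & S (x - t *: unitv i + c *: unitv j)) ->
  rho <= C.
Proof.
move=> Hf HS HC xi rho0 d0 dx cross.
pose A r c := x - r *: unitv i + c *: unitv j.
have AE r c k : A r c 0 k = x 0 k - r *+ (k == i) + c *+ (k == j).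
  by rewrite /A -scaleNr !shiftE mulNrn.
have Aup r c s : A r c + s *: unitv i = A (r - s) c.
  by rewrite /A addrAC scalerBl opprB addrA [in RHS]addrAC.
have Adown r c s : A r c - s *: unitv i = A (r + s) c.
  by rewrite -scaleNr Aup opprK.
have Ac r c : A r c = A r 0 + c *: unitv j by rewrite /A scale0r addr0.
have Ale r c c' : c <= c' -> vle (A r c) (A r c').
  by move=> cc; rewrite /A; exact: vle_shift.
have A0 r c : r <= x 0 i -> 0 <= c -> orthant (A r c).
  move=> rx c0; apply: (orthant_vle _ (Ale r 0 c c0)) => k.
  rewrite AE mul0rn addr0; case: eqP => [->|_]; first by rewrite subr_ge0.
  by rewrite subr0 ltW.
have Ai r c : r < x 0 i -> 0 <= c -> inner (A r c).
  move=> rx c0 k; apply: (lt_le_trans _ (Ale r 0 c c0 k)).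
  rewrite AE mul0rn addr0; case: eqP => [->|_]; first by rewrite subr_gt0.
  by rewrite subr0.
(* The increment of length [s] ending at [r] on the upper edge against the next
   one, beginning at [r], on the lower edge: between them sits a surface point
   with second difference at least [s]. *)
have step r s : 0 < s -> 0 <= r <= rho * d -> r + s < x 0 i ->
    f (A (r - s) d) - f (A r d) <= f (A r 0) - f (A (r + s) 0) - s.
  move=> s0 rd rsx; have [c /andP[c0 cd] Sc] := cross r rd.
  have rx : r < x 0 i by lra.
  have Ap0 : orthant (A r c) by apply: A0 => //; exact: ltW.
  have z0 : orthant (A (r + s) 0) by apply: A0 => //; exact: ltW.
  have scx : 0 < s < A r c 0 i.
    rewrite s0 /=; apply: (lt_le_trans _ (Ale r 0 c c0 i)).
    by rewrite AE mul0rn addr0 eqxx mulr1n; lra.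
  have := feasible_second_difference Hf HS Sc (Ai r c rx c0) scx.
  have := increment_antitone i Hf Ap0 (Ale r c d cd) (ltW s0).
  have := increment_antitone i Hf z0 (Ale (r + s) 0 c c0) (ltW s0).
  rewrite -/(A r c) Adown !Aup addrK; lra.
(* The increments compared in [step] are offset by one position, so the
   telescoping sums leave an extra increment [s] along [e_i], of size at most
   [C s]; this is the second term of the bound. *)
have bound (N : nat) : rho <= C + C * rho / N.+1%:R.
  pose s := rho * d / N.+1%:R.
  have rd0 : 0 < rho * d by rewrite mulr_gt0.
  have s0 : 0 < s by rewrite divr_gt0.
  have Ns : N.+1%:R * s = rho * d by rewrite mulrC divfK ?pnatr_eq0.
  have sd : s <= rho * d by rewrite -Ns ler_peMl ?ler1n ?ltW.
  have sumk (m : nat) : (m <= N.+1)%N ->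
      f (A 0 d) - f (A (m%:R * s) d) <=
      f (A s 0) - f (A (m%:R * s + s) 0) - m%:R * s.
    elim: m => [_|m IH mN]; first by rewrite mul0r add0r !subrr.
    have E : m.+1%:R * s = m%:R * s + s by rewrite -natr1 mulrDl mul1r.
    have mr : m.+1%:R * s <= rho * d by rewrite -Ns ler_pM2r // ler_nat.
    have := step (m.+1%:R * s) s s0.
    rewrite mr mulr_ge0 ?(ltW s0) // => /(_ isT).
    have -> : m.+1%:R * s - s = m%:R * s by rewrite E addrK.
    have := IH (ltnW mN); rewrite -E => {}IH.
    have lx : m.+1%:R * s + s < x 0 i by lra.
    by move=> /(_ lx); rewrite E in IH *; lra.
  have := sumk N.+1 (leqnn _); rewrite Ns => total.
  have rsx : rho * d + s <= x 0 i by lra.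
  have := increment_le_Cost j Hf HC (A0 (rho * d + s) 0 rsx (lexx 0)) (ltW d0).
  have := increment_le_Cost i Hf HC (A0 (rho * d + s) d rsx (ltW d0)) (ltW s0).
  rewrite -Ac Aup addrK => up_i up_j.
  have top : f (A s 0) <= f (A 0 d).
    apply: (el_nondecreasing Hf); first by apply: A0 => //; lra.
    apply: (vle_trans (q := A 0 0)); last exact/Ale/ltW.
    have <- : A s 0 + s *: unitv i = A 0 0 by rewrite Aup subrr.
    exact/vle_shiftr/ltW.
  rewrite -(ler_pM2r d0) mulrDl.
  have -> : C * rho / N.+1%:R * d = C * s by rewrite /s; ring.
  lra.
have C0 : 0 <= C.
  have := increment_le_Cost i Hf HC orthant0 ler01; rewrite mulr1; apply: le_trans.
  rewrite subr_ge0; apply: (el_nondecreasing Hf orthant0).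
  by apply: vle_shiftr.
apply/ler_addgt0Pr => eps eps0.
apply: (le_trans (bound (Num.truncn (C * rho / eps)))); rewrite lerD2l.
by rewrite ler_pdivrMr ?ltr0n // [leRHS]mulrC -ler_pdivrMr // ltW // truncnS_gt.
Qed.

End EntropyLike.

(** * Zero sets crossed by segments *)

Section DirectionalMVT.
Context {R : realType} {V : normedModType R}.
Implicit Types (g : V -> R) (x y u w : V).

Lemma is_derive_line g y u (t : R) : derivable g (y + t *: u) u ->
  is_derive t 1 (fun s => g (y + s *: u)) ('D_u g (y + t *: u)).
Proof.
move=> dg.
have E : (fun h : R => h^-1 *: (((fun s => g (y + s *: u)) \o shift t) (h *: 1)
            - g (y + t *: u)))
       = (fun h : R => h^-1 *: ((g \o shift (y + t *: u)) (h *: u) - g (y + t *: u))).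
  apply/funext => h /=; congr (_ *: (g _ - _)).
  by rewrite scaler1 scalerDl addrCA.
by split; rewrite /derivable /derive E.
Qed.

Lemma MVT_line g y u (r : R) : 0 <= r ->
  (forall s : R, 0 <= s <= r -> derivable g (y + s *: u) u) ->
  exists2 c : R, 0 <= c <= r & g (y + r *: u) - g y = 'D_u g (y + c *: u) * r.
Proof.
move=> r0 dg; pose h s := g (y + s *: u).
have dh s : s \in `[0, r] -> is_derive s 1 h ('D_u g (y + s *: u)).
  by rewrite in_itv /= => sr; exact/is_derive_line/dg.
have ho s : s \in `]0, r[ -> is_derive s 1 h ('D_u g (y + s *: u)).
  by move=> sr; apply: dh; exact: subset_itv_oo_cc sr.
have hc : {within `[0, r], continuous h}.
  by apply: derivable_within_continuous => s /dh[].
have [c] := MVT_segment r0 ho hc.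
rewrite in_itv /= => cr; rewrite /h scale0r addr0 subr0 => E.
by exists c.
Qed.

(** Near [x] the derivatives along [u] and [w] keep their strict inequality,
    with a constant [a] between [rho * D_u g] and [D_w g]. Descending along [u]
    from [x] makes [g] nonpositive; the climb of [d] along [w] gains at least
    [a d], and the descent of at most [rho d] loses at most that. Hence [g]
    changes sign on each segment [x - t u + [0, d] w]. *)
Lemma zero_set_crossing g x u w (U : set V) (rho : R) :
  nbhs x U ->
  (forall y, U y -> derivable g y u /\ derivable g y w) ->
  {for x, continuous ('D_u g)} -> {for x, continuous ('D_w g)} ->
  g x = 0 -> 0 < 'D_u g x -> 0 <= rho -> rho * 'D_u g x < 'D_w g x ->
  \forall d \near 0^'+, forall t : R, 0 <= t <= rho * d ->
    exists2 c : R, 0 <= c <= d &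
      U (x - t *: u + c *: w) /\ g (x - t *: u + c *: w) = 0.
Proof.
move=> xU gU cu cw gx0 Du0 rho0 Duw.
pose a := (rho * 'D_u g x + 'D_w g x) / 2.
have ua : rho * 'D_u g x < a by rewrite /a; lra.
have aw : a < 'D_w g x by rewrite /a; lra.
pose W := [set y | [/\ U y, 0 < 'D_u g y, rho * 'D_u g y < a & a < 'D_w g y]].
have xW : nbhs x W.
  near=> y; split; near: y.
  - exact: xU.
  - exact: (cvgr_gt _ cu).
  - by apply: (cvgr_lt (rho * 'D_u g x)) => //; exact: cvgMl_tmp.
  - exact: (cvgr_gt _ cw).
have [r /= r0 rW] := (nbhs_normP _ _).1 xW.
(* [d * K] bounds the norm of the displacements [- s u + c w] in the strip. *)
pose K := rho * `|u| + `|w| + 1.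
have K0 : 0 < K by rewrite ltr_wpDl // addr_ge0 // mulr_ge0.
near=> d => t /andP[t0 td].
have d0 : 0 < d by near: d; exact: nbhs_right_gt.
have dr : d * K < r.
  by rewrite -ltr_pdivlMr //; near: d; apply: nbhs_right_lt; rewrite divr_gt0.
have box (s c : R) : 0 <= s <= rho * d -> 0 <= c <= d -> W (x - s *: u + c *: w).
  move=> /andP[s0 sd] /andP[c0 cd]; apply: rW => /=.
  rewrite opprD opprB addrA [x + _]addrC subrK.
  apply: le_lt_trans dr; apply: (le_trans (ler_normB _ _)).
  rewrite !normrZ !ger0_norm //.
  rewrite /K !mulrDr mulr1.
  apply: (@le_trans _ _ (d * (rho * `|u|) + d * `|w|)); last first.
    by rewrite lerDl ltW.
  apply: lerD; last exact: ler_wpM2r.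
  by rewrite mulrA ler_wpM2r // mulrC.
have t0d : 0 <= t <= rho * d by rewrite t0.
have rd0 : 0 <= rho * d by exact: le_trans td.
have [derU derW] : (forall s c : R, 0 <= s <= rho * d -> 0 <= c <= d ->
    derivable g (x - s *: u + c *: w) u) /\
  (forall s c : R, 0 <= s <= rho * d -> 0 <= c <= d ->
    derivable g (x - s *: u + c *: w) w).
  by split=> s c sd cd; have [/gU[]] := box s c sd cd.
have r00 : 0 <= (0 : R) <= rho * d by rewrite lexx rd0.
have d00 : 0 <= (0 : R) <= d by rewrite lexx ltW.
have dd : 0 <= d <= d by rewrite lexx ltW.
have descent (c : R) : 0 <= c <= d -> exists2 s : R, 0 <= s <= rho * d &
    g (x + c *: w) - g (x - t *: u + c *: w) = 'D_u g (x - s *: u + c *: w) * t.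
  move=> cd; have E s : x - t *: u + c *: w + s *: u = x - (t - s) *: u + c *: w.
    by rewrite addrAC scalerBl opprB addrA [in RHS]addrAC.
  have [|s /andP[s0 st]] := @MVT_line g (x - t *: u + c *: w) u t t0.
    by move=> s /andP[s0 st]; rewrite E; apply: derU => //; lra.
  by rewrite !E subrr scale0r subr0 => ->; exists (t - s) => //; lra.
have lo : g (x - t *: u) <= 0.
  have [s sd] := descent 0 d00; rewrite !scale0r !addr0 gx0 => E.
  have [_ Dc _ _] := box s 0 sd d00.
  by rewrite -oppr_ge0 -sub0r E mulr_ge0 // ltW //; move: Dc; rewrite scale0r addr0.
have hi : 0 <= g (x - t *: u + d *: w).
  have [s sd E] := descent d dd.
  have [|c cd F] := @MVT_line g x w d (ltW d0).
    move=> c cd; have := derW 0 c; rewrite scale0r subr0; exact.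
  have [_ Ds Dsa _] := box s d sd dd.
  have [_ _ _] := box 0 c r00 cd.
  rewrite scale0r subr0 => Dc.
  have : 'D_u g (x - s *: u + d *: w) * t <= a * d.
    apply: (le_trans (ler_wpM2l (ltW Ds) td)).
    by rewrite mulrA ler_wpM2r ?(ltW d0) // mulrC ltW.
  have : a * d <= 'D_w g (x + c *: w) * d by rewrite ler_wpM2r ?ltW.
  by move: E F; rewrite gx0; lra.
pose h c := g (x - t *: u + c *: w).
have hc : {within `[0, d], continuous h}.
  apply: derivable_within_continuous => c; rewrite in_itv /= => cd.
  by have [] := is_derive_line (derW t c t0d cd).
have h0 : Num.min (h 0) (h d) <= 0 <= Num.max (h 0) (h d).
  by rewrite /h scale0r addr0 ge_min lo le_max hi orbT.
have [c] := IVT (ltW d0) hc h0; rewrite in_itv /= => cd E.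
by exists c => //; split=> //; have [] := box t c t0d cd.
Unshelve. all: by end_near. Qed.

End DirectionalMVT.

(** * The surface seen from an inner point *)

(** Descending at most [rho * d] along [e_i] and then climbing [e_j] meets the
    surface within height [d], as long as [rho] is below the slope
    [v_j / v_i] of the tangent hyperplane; staying close to [x] keeps the
    crossing points inside the domain of the local equation and among the
    inner points, where that equation describes the surface. *)
Lemma surface_crossing (R : realType) (n : nat) (S D : set 'rV[R]_n)
    (x v : 'rV[R]_n) (i j : 'I_n) (rho : R) :
  S x -> inner x -> outward_normal S D x v -> 0 < v 0 i ->
  0 <= rho -> rho * v 0 i < v 0 j ->
  \forall d \near 0^'+, forall t : R, 0 <= t <= rho * d ->
    exists2 c : R, 0 <= c <= d & S (x - t *: unitv i + c *: unitv j).
Proof.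
move=> Sx x_inner [U [g [[oU Ux smg _ gS] vE]]] vi0 rho0 rhov.
have v_D k : v 0 k = 'D_(unitv k) g x by rewrite vE mxE.
have [_ smg1] := smg 1%N; have g0 : g x = 0.
  have x0 : orthant x by move=> k; exact/ltW/x_inner.
  by have [[-> //] _ _] := gS x Ux x0.
have near_x : nbhs x (U `&` inner).
  apply: filterI; first exact: open_nbhs_nbhs.
  have near_gt0 (k : 'I_n) : nbhs x [set y : 'rV[R]_n | 0 < y 0 k].
    have cont_k : (fun y : 'rV[R]_n => y 0 k) @ x --> x 0 k by exact: coord_continuous.
    exact: (cvgr_gt _ cont_k _ (x_inner k)).
  exact: (filter_forall (nbhs_filter x) near_gt0).
have crossing := zero_set_crossing (u := unitv i) (w := unitv j) (rho := rho) near_x.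
have {}crossing := crossing g _ ((smg1 i).2.1 _ Ux) ((smg1 j).2.1 _ Ux) g0.
rewrite -!v_D in crossing.
have {}crossing := crossing _ vi0 rho0 rhov.
have dg y : (U `&` inner) y -> derivable g y (unitv i) /\ derivable g y (unitv j).
  by move=> [Uy _]; split; [exact: (smg1 i).1 | exact: (smg1 j).1].
apply: filterS (crossing dg) => d cross t td.
have [c cd [[Uy yi] gy]] := cross t td; exists c => //.
have y0 : orthant (x - t *: unitv i + c *: unitv j) by move=> k; exact/ltW/yi.
by have [[_ S_of_zero] _ _] := gS _ Uy y0; exact: S_of_zero.
Qed.

Theorem theorem7 (R : realType) (n : nat) (n_gt0 : (1 <= n)%N)
    (S D : set 'rV[R]_n) (SD : s_surface S D)
    (x : 'rV[R]_n) (Sx : S x) (x_inner : inner x)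
    (v : 'rV[R]_n) (normal_v : outward_normal S D x v) (i j : 'I_n) :
  ((v 0 j / v 0 i)%:E <= OPT S)%E.
Proof.
have v_gt0 := ss_normal_pos SD Sx normal_v.
apply: le_ereal_inf_tmp => _ [f [Hf HS] <-].
rewrite leNgt; apply/negP => Cost_lt.
have [C [HC Cv]] : exists C : R, (Cost f <= C%:E)%E /\ C < v 0 j / v 0 i.
  move: Cost_lt; case: (Cost f) => [C|//|] H.
    by exists C; rewrite lexx -lte_fin.
  by exists (v 0 j / v 0 i - 1); rewrite leNye; split=> //; lra.
(* a positive slope strictly between [C] and [v_j / v_i] *)
pose rho := (Num.max 0 C + v 0 j / v 0 i) / 2.
have vv : 0 < v 0 j / v 0 i by rewrite divr_gt0.
have mv : Num.max 0 C < v 0 j / v 0 i by rewrite gt_max vv.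
have m0 : 0 <= Num.max 0 C by rewrite le_max lexx.
have mC : C <= Num.max 0 C by rewrite le_max lexx orbT.
have rho0 : 0 < rho by rewrite /rho; lra.
have rhoC : C < rho by rewrite /rho; lra.
have rhov : rho * v 0 i < v 0 j.
  by rewrite -ltr_pdivlMr // /rho; lra.
have near_d := surface_crossing Sx x_inner normal_v (v_gt0 i) (ltW rho0) rhov.
have [d [d0 dx cross]] : exists d, [/\ 0 < d, rho * d + rho * d < x 0 i &
   forall t, 0 <= t <= rho * d ->
    exists2 c, 0 <= c <= d & S (x - t *: unitv i + c *: unitv j)].
  near (0 : R)^'+ => d; exists d; split.
  - by near: d; exact: nbhs_right_gt.
  - rewrite -mulrDl mulrC -ltr_pdivlMr ?addr_gt0 //.
    by near: d; apply: nbhs_right_lt; rewrite divr_gt0 ?addr_gt0.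
  - by near: d.
have := slope_le_Cost Hf HS HC x_inner rho0 d0 dx cross.
by rewrite leNgt rhoC.
Unshelve. all: by end_near. Qed.
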